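(* Let $v:[t_0,T_q)\to\mathbb{R}^{N_xN_y}$ be a solution of the semi-discretized system $$v'(t)=Mv(t)+g(\varepsilon,v(t)),\quad t_0<t<T_q,\qquad v(t_0)=v_0,$$ whose components satisfy $0\le u<1$ (that is, $0\le v(t)<1$ for $t_0\le t<T_q$). Then $v(t)>0$ for all $t_0<t<T_q$.
   Context: All vector inequalities are componentwise. Mesh: $\mathcal{D}=(-1,1)\times(-1,1)$, $a,b>0$, $N_x,N_y$ are (large) positive integers, $-1=x_0<x_1<\dots<x_{N_x+1}=1$, $-1=y_0<\dots<y_{N_y+1}=1$, $h_{x,i}=x_{i+1}-x_i>0$ ($0\le i\le N_x$), $h_{y,j}=y_{j+1}-y_j>0$ ($0\le j\le N_y$); the mesh is otherwise arbitrary. The degeneracy function $\sigma:\overline{\mathcal{D}}\to[0,\infty)$ vanishes only on a subset of $\partial\mathcal{D}$; $\sigma_{i,j}=\sigma(x_i,y_j)$. Interior grid vectors $v=(v_{1,1},v_{2,1},\dots,v_{N_x,1},v_{1,2},\dots,v_{N_x,N_y})^{T}\in\mathbb{R}^{N_xN_y}$ are ordered lexicographically. Matrices: $B=\mathrm{diag}(\sigma_{1,1}^{-1},\sigma_{2,1}^{-1},\dots,\sigma_{N_x,N_y}^{-1})$ (same ordering); for $\alpha\in\{x,y\}$, $T_\alpha\in\mathbb{R}^{N_\alpha\times N_\alpha}$ is tridiagonal with $(T_\alpha)_{i,i}=-\frac{2}{h_{\alpha,i-1}h_{\alpha,i}}$, $(T_\alpha)_{i,i+1}=\frac{2}{h_{\alpha,i}(h_{\alpha,i-1}+h_{\alpha,i})}$,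 $(T_\alpha)_{i+1,i}=\frac{2}{h_{\alpha,i}(h_{\alpha,i}+h_{\alpha,i+1})}$; $M=a^{-2}B(I_{N_y}\otimes T_x)+b^{-2}B(T_y\otimes I_{N_x})$. Reaction term: $\varepsilon=\varepsilon(x,y)$ is a bounded stochastic influence (fixed in time). For each value of $\varepsilon$, $f(\varepsilon,\cdot)$ is a differentiable function on $[0,1)$ with $f(\varepsilon,0)>0$, $f_u(\varepsilon,u)>0$, $\lim_{u\to1^-}f(\varepsilon,u)=\infty$, $\int_0^1 f(\varepsilon,u)\,du=\infty$, and for each $u\in[0,1)$ the values $f(\varepsilon,u)$ are bounded above and bounded below by a positive constant as $\varepsilon$ varies. For $v\in[0,1)^{N_xN_y}$, $g(\varepsilon,v)$ is the vector with components $f(\varepsilon(x_i,y_j),v_{i,j})/\sigma_{i,j}$. *)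

(* Defs.v *)
From mathcomp Require Import all_boot all_order all_algebra.
From mathcomp Require Import all_classical all_reals all_analysis.
From mathcomp Require Import mxtens.

Set Implicit Arguments.
Unset Strict Implicit.
Unset Printing Implicit Defensive.

Import Order.TTheory GRing.Theory Num.Theory.
Import numFieldNormedType.Exports.

Local Open Scope classical_set_scope.
Local Open Scope ring_scope.

Definition boundary (T : topologicalType) (A : set T) : set T :=
  closure A `\` interior A.

Definition square (R : realType) : set (R * R) := `]-1, 1[ `*` `]-1, 1[.

(* Only the values x 0, ..., x N.+1 are mesh points; the rest of the sequence
   is irrelevant. *)
Definition is_mesh (R : realType) (N : nat) (x : nat -> R) : Prop :=
  [/\ x 0%N = -1, x N.+1 = 1 & forall i, (i <= N)%N -> x i < x i.+1].

Definition step (R : realType) (x : nat -> R) (i : nat) : R := x i.+1 - x i.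

(* Ordinals are 0-based, the interior mesh points are numbered 1, ..., N:
   row i and column j of the matrix carry the mesh indices i.+1 and j.+1. *)
Definition second_diff (R : realType) (N : nat) (x : nat -> R) : 'M[R]_N :=
  let h := step x in
  \matrix_(i < N, j < N)
    let k := i.+1 in
    let l := j.+1 in
    if l == k then - (2 / (h k.-1 * h k))
    else if l == k.+1 then 2 / (h k * (h k.-1 + h k))
    else if k == l.+1 then 2 / (h l * (h l + h l.+1))
    else 0.

(* Lexicographic ordering with the x-index i running fastest: the component of
   index (j - 1) * Nx + (i - 1) is F i j, for 1 <= i <= Nx and 1 <= j <= Ny.
   This is the indexing convention of the Kronecker product *t. *)
Definition grid_vec (R : realType) (Nx Ny : nat) (F : nat -> nat -> R) :
    'cV[R]_(Ny * Nx) :=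
  \col_k let ji := mxtens_unindex k in F ji.2.+1 ji.1.+1.

Section SemiDiscretization.
Variables (R : realType) (Nx Ny : nat) (x y : nat -> R) (sigma : R * R -> R).

Definition degeneracy_mx : 'M[R]_(Ny * Nx) :=
  diag_mx (grid_vec Nx Ny (fun i j => (sigma (x i, y j))^-1))^T.

Definition system_mx (a b : R) : 'M[R]_(Ny * Nx) :=
  a ^- 2 *: (degeneracy_mx *m (1%:M *t second_diff Nx x))
  + b ^- 2 *: (degeneracy_mx *m (second_diff Ny y *t 1%:M)).

Definition reaction (f : R -> R -> R) (eps : R * R -> R)
    (v : 'cV[R]_(Ny * Nx)) : 'cV[R]_(Ny * Nx) :=
  \col_k let ji := mxtens_unindex k in
    let p := (x ji.2.+1, y ji.1.+1) in
    f (eps p) (v k ord0) / sigma p.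

End SemiDiscretization.

Definition is_degeneracy (R : realType) (sigma : R * R -> R) : Prop :=
  (forall p, closure (@square R) p -> 0 <= sigma p) /\
  (forall p, closure (@square R) p -> sigma p = 0 -> boundary (@square R) p).

(* Derivative relative to A, hence one-sided at an endpoint of A. *)
Definition has_derivative_in (R : realType) (A : set R) (f : R -> R)
    (u l : R) : Prop :=
  (f w - f u) / (w - u) @[w --> within A (dnbhs u)] --> l.

(* E is the set of values taken by the stochastic influence; for e in E the
   function f e is only constrained on [0, 1). *)
Definition is_reaction (R : realType) (E : set R) (f : R -> R -> R) : Prop :=
  (forall e, E e ->
    [/\ 0 < f e 0,
        forall u, 0 <= u < 1 ->
          exists2 l, has_derivative_in `[0, 1[ (f e) u l & 0 < l,
        f e u @[u --> 1^'-] --> +oo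
      & (\int[lebesgue_measure]_(u in `[0%R, 1%R[) (f e u)%:E = +oo)%E]) /\
  (forall u, 0 <= u < 1 ->
    exists m M, 0 < m /\ forall e, E e -> m <= f e u <= M).

Definition influence_values d (Omega : measurableType d) (R : realType)
    (P : probability Omega R) (eps : R * R -> {RV P >-> R}) : set R :=
  [set e | exists2 p, square p & exists omega, e = eps p omega].

(* v is a total function of time, but only its values on [t0, Tq) matter;
   Tq may be infinite. *)
Definition is_solution (R : realType) (n : nat) (F : 'cV[R]_n -> 'cV[R]_n)
    (t0 : R) (Tq : \bar R) (v0 : 'cV[R]_n) (v : R -> 'cV[R]_n) : Prop :=
  [/\ {within [set t | t0 <= t /\ (t%:E < Tq)%E], continuous v},
      forall t, t0 < t -> (t%:E < Tq)%E -> is_derive t 1 v (F (v t))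
    & v t0 = v0].

(* Main.v *)
Require Import Defs.
From mathcomp Require Import all_boot all_order all_algebra.
From mathcomp Require Import all_classical all_reals all_analysis.
From mathcomp Require Import mxtens.
Import Order.TTheory GRing.Theory Num.Theory.
Import numFieldNormedType.Exports.
Local Open Scope classical_set_scope.
Local Open Scope ring_scope.

Set Implicit Arguments.
Unset Strict Implicit.
Unset Printing Implicit Defensive.

(** The positivity is a differential version of the discrete maximum principle.
    If a component [v k] of the solution vanished at a time [t] in the open
    interval of existence, then [t] would be an interior minimum of the
    nonnegative function [v k], so its derivative there would be [0].  The
    system contradicts this: every off-diagonal entry of the matrix is
    nonnegative ([system_mx_offdiag_ge0]), so the neighbours push the vanishing
    component upwards ([offdiag_ge0_mulmx]), and the reaction term adds
    [f (eps p) 0 / sigma p], which is positive because interior mesh points lie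
    in the open square, where the degeneracy function is positive
    ([degeneracy_gt0]). *)

(** These are the Metzler matrices, the generators of linear flows that
    preserve the nonnegative orthant. *)
Definition offdiag_ge0 {R : numDomainType} {n : nat} (A : 'M[R]_n) :=
  forall i j, i != j -> 0 <= A i j.

Lemma offdiag_ge0D (R : numDomainType) (n : nat) (A B : 'M[R]_n) :
  offdiag_ge0 A -> offdiag_ge0 B -> offdiag_ge0 (A + B).
Proof. by move=> A0 B0 i j ij; rewrite mxE addr_ge0 ?A0 ?B0. Qed.

Lemma offdiag_ge0Z (R : numDomainType) (n : nat) (c : R) (A : 'M[R]_n) :
  0 <= c -> offdiag_ge0 A -> offdiag_ge0 (c *: A).
Proof. by move=> c0 A0 i j ij; rewrite mxE mulr_ge0 ?A0. Qed.

Lemma offdiag_ge0_diag_mul (R : numDomainType) (n : nat) (d : 'rV[R]_n)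
    (A : 'M[R]_n) :
  (forall i, 0 <= d 0 i) -> offdiag_ge0 A -> offdiag_ge0 (diag_mx d *m A).
Proof.
by move=> d0 A0 i j ij; rewrite mul_diag_mx mxE mulr_ge0 ?A0.
Qed.

(** The entry at [((i, j), (i', j'))] is a Kronecker delta in the first indices
    times [A j j'], so a nonzero off-diagonal entry of the tensor product comes
    from an off-diagonal entry of [A]. *)
Lemma offdiag_ge0_tens1l (R : numDomainType) (m n : nat) (A : 'M[R]_n) :
  offdiag_ge0 A -> offdiag_ge0 ((1%:M : 'M[R]_m) *t A).
Proof.
move=> A0 k l; case: (mxtens_indexP k) => i j; case: (mxtens_indexP l) => i' j'.
rewrite tensmxE mxE; case: (eqVneq i i') => [->|_]; last by rewrite mul0r.
by rewrite mul1r => jj'; apply: A0; apply: contraNneq jj' => ->.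
Qed.

Lemma offdiag_ge0_tens1r (R : numDomainType) (m n : nat) (A : 'M[R]_m) :
  offdiag_ge0 A -> offdiag_ge0 (A *t (1%:M : 'M[R]_n)).
Proof.
move=> A0 k l; case: (mxtens_indexP k) => i j; case: (mxtens_indexP l) => i' j'.
rewrite tensmxE mxE; case: (eqVneq j j') => [->|_]; last by rewrite mulr0.
by rewrite mulr1 => ii'; apply: A0; apply: contraNneq ii' => ->.
Qed.

(** Only the diagonal entry could contribute negatively to row [k], and it is
    multiplied by [w k = 0]. *)
Lemma offdiag_ge0_mulmx (R : numDomainType) (n : nat) (A : 'M[R]_n)
    (w : 'cV[R]_n) (k : 'I_n) :
  offdiag_ge0 A -> (forall l, 0 <= w l 0) -> w k 0 = 0 -> 0 <= (A *m w) k 0.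
Proof.
move=> A0 w0 wk; rewrite mxE; apply: sumr_ge0 => l _.
by have [<-|kl] := eqVneq k l; rewrite ?wk ?mulr0// mulr_ge0 ?A0.
Qed.

Lemma step_gt0 (R : realType) (N : nat) (x : nat -> R) (i : nat) :
  is_mesh N x -> (i <= N)%N -> 0 < step x i.
Proof. by move=> [_ _ hx] iN; rewrite subr_gt0 hx. Qed.

Lemma mesh_interior (R : realType) (N : nat) (x : nat -> R) (i : nat) :
  is_mesh N x -> (i < N)%N -> -1 < x i.+1 < 1.
Proof.
move=> [x0 x1 hx].
have mono n j : (j + n <= N)%N -> x j < x (j + n).+1.
  elim: n => [|n IHn]; first by rewrite addn0; exact: hx.
  rewrite addnS => jnN; apply: lt_trans (IHn (ltnW jnN)) _; exact: hx.
move=> iN; apply/andP; split.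
  by rewrite -x0; exact: (mono i 0%N (ltnW iN)).
by have := mono (N - i.+1)%N i.+1; rewrite subnKC// x1; apply.
Qed.

(** The open square is disjoint from its boundary, the only place where [sigma]
    may vanish. *)
Lemma degeneracy_gt0 (R : realType) (sigma : R * R -> R) (p : R * R) :
  is_degeneracy sigma -> square p -> 0 < sigma p.
Proof.
move=> [sge0 s0] sqp; have clp : closure (@square R) p by exact: subset_closure.
rewrite lt_neqAle eq_sym sge0// andbT; apply/eqP => /(s0 _ clp) [_]; apply.
rewrite /interior; exists (`]-1, 1[%classic, `]-1, 1[%classic) => //=.
by case: sqp => p1 p2; split; apply: open_nbhs_nbhs; split => //;
  exact: interval_open.
Qed.

Lemma second_diff_offdiag_ge0 (R : realType) (N : nat) (x : nat -> R) :
  is_mesh N x -> offdiag_ge0 (second_diff N x).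
Proof.
move=> hx i j ij; rewrite mxE /= eqSS.
have quotient_ge0 k l m : (k <= N)%N -> (l <= N)%N -> (m <= N)%N ->
    0 <= 2 / (step x k * (step x l + step x m)).
  move=> kN lN mN; apply/ltW/divr_gt0 => //.
  by apply: mulr_gt0; [|apply: addr_gt0]; exact: (step_gt0 hx).
rewrite (_ : (j == i :> nat) = false); last by rewrite eq_sym; exact/negbTE.
have [iN jN] := (ltn_ord i, ltn_ord j).
case: ifP => _; first exact: quotient_ge0 (ltnW iN) iN.
by case: ifP => // /eqP[ij1]; apply: quotient_ge0 => //; rewrite -ij1.
Qed.

Lemma square_mesh_point (R : realType) (Nx Ny : nat) (x y : nat -> R)
    (i : 'I_Nx) (j : 'I_Ny) :
  is_mesh Nx x -> is_mesh Ny y -> square (x i.+1, y j.+1).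
Proof.
by move=> hx hy; split => /=; rewrite in_itv/=;
  [exact: (mesh_interior hx)|exact: (mesh_interior hy)].
Qed.

(** Tensoring with an identity matrix, scaling the rows by [1 / sigma > 0] and
    adding all preserve nonnegativity off the diagonal, so the property passes
    from the two one-dimensional difference matrices to the full system. *)
Lemma system_mx_offdiag_ge0 (R : realType) (a b : R) (Nx Ny : nat)
    (x y : nat -> R) (sigma : R * R -> R) :
  is_mesh Nx x -> is_mesh Ny y -> is_degeneracy sigma ->
  offdiag_ge0 (system_mx Nx Ny x y sigma a b).
Proof.
move=> hx hy hs.
have B0 k : 0 <= (grid_vec Nx Ny (fun i j => (sigma (x i, y j))^-1))^T 0 k.
  by rewrite !mxE invr_ge0 ltW// degeneracy_gt0//; exact: square_mesh_point.
apply: offdiag_ge0D; apply: offdiag_ge0Z; rewrite ?invr_ge0 ?sqr_ge0//;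
  apply: offdiag_ge0_diag_mul => //.
- exact/offdiag_ge0_tens1l/second_diff_offdiag_ge0.
- exact/offdiag_ge0_tens1r/second_diff_offdiag_ge0.
Qed.

Lemma reaction_gt0 (R : realType) (Nx Ny : nat) (x y : nat -> R)
    (sigma : R * R -> R) (f : R -> R -> R) (eps : R * R -> R)
    (w : 'cV[R]_(Ny * Nx)) (k : 'I_(Ny * Nx)) :
  is_mesh Nx x -> is_mesh Ny y -> is_degeneracy sigma ->
  (forall p, square p -> 0 < f (eps p) 0) -> w k 0 = 0 ->
  0 < reaction x y sigma f eps w k 0.
Proof.
move=> hx hy hs f0 wk; rewrite mxE wk.
by rewrite divr_gt0 ?f0 ?degeneracy_gt0//; exact: square_mesh_point.
Qed.

Lemma is_derive_coord (R : realType) (m n : nat) (v : R -> 'M[R]_(m, n))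
    (t : R) (w : 'M[R]_(m, n)) (i : 'I_m) (j : 'I_n) :
  is_derive t 1 v w -> is_derive t 1 (fun s => v s i j) (w i j).
Proof.
move=> [dv <-]; apply: DeriveDef; first exact: (derivable_mxP _ _ _).1.
by rewrite derive_mx// mxE.
Qed.

Lemma exists_real_between (R : realType) (t : R) (T : \bar R) :
  (t%:E < T)%E -> exists2 c, t < c & (c%:E < T)%E.
Proof.
case: T => [T| |] //; last by exists (t + 1); rewrite ?ltrDl ?ltry.
rewrite lte_fin => tT; exists ((t + T) / 2); rewrite ?lte_fin midf_lt//.
Qed.

(** A zero of the nonnegative function [u] is a minimum.  As [T] may be infinite,
    the minimum is taken over [t0 < s < c] for a real [c] between [t] and [T]. *)
Lemma derive_eq0_at_zero (R : realType) (u u' : R -> R) (t0 : R) (T : \bar R)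
    (t : R) :
  (forall s, t0 < s -> (s%:E < T)%E -> is_derive s 1 u (u' s)) ->
  (forall s, t0 < s -> (s%:E < T)%E -> 0 <= u s) ->
  t0 < t -> (t%:E < T)%E -> u t = 0 -> u' t = 0.
Proof.
move=> du u0 t0t tT ut; have [c tc cT] := exists_real_between tT.
have inT s : s \in `]t0, c[%R -> t0 < s /\ (s%:E < T)%E.
  rewrite in_itv/= => /andP[t0s sc]; split => //.
  by rewrite (lt_trans _ cT)// lte_fin.
have t0c : t0 <= c by rewrite ltW// (lt_trans t0t).
have ht : t \in `]t0, c[%R by rewrite in_itv/= t0t.
have dt := du _ t0t tT.
have d0 : is_derive t 1 u 0.
  apply: (derive1_at_min t0c _ ht) => s /inT[t0s sT].
  - by have [] := du _ t0s sT.
  - by rewrite ut u0.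
by rewrite -(@derive_val _ _ _ _ _ _ _ dt) (@derive_val _ _ _ _ _ _ _ d0).
Qed.

Theorem lemma3p3 (R : realType) (a b : R) (ha : 0 < a) (hb : 0 < b)
  (Nx Ny : nat) (hNx : (0 < Nx)%N) (hNy : (0 < Ny)%N)
  (x y : nat -> R) (hx : is_mesh Nx x) (hy : is_mesh Ny y)
  (sigma : R * R -> R) (hsigma : is_degeneracy sigma)
  (d : measure_display) (Omega : measurableType d) (P : probability Omega R)
  (eps : R * R -> {RV P >-> R})
  (heps : exists C : R, forall e, influence_values eps e -> `|e| <= C)
  (f : R -> R -> R) (hf : is_reaction (influence_values eps) f)
  (omega : Omega) (t0 : R) (Tq : \bar R) (htq : (t0%:E < Tq)%E)
  (v0 : 'cV[R]_(Ny * Nx)) (v : R -> 'cV[R]_(Ny * Nx))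
  (hv : is_solution
    (fun w => system_mx Nx Ny x y sigma a b *m w
              + reaction x y sigma f (fun p => eps p omega) w) t0 Tq v0 v)
  (hv01 : forall t, t0 <= t -> (t%:E < Tq)%E ->
    forall k, 0 <= v t k ord0 < 1) :
  forall t, t0 < t -> (t%:E < Tq)%E -> forall k, 0 < v t k ord0.
Proof.
have [_ dv _] := hv.
have f0 p : square p -> 0 < f (eps p omega) 0.
  move=> sqp; have evp : influence_values eps (eps p omega).
    by exists p => //; exists omega.
  by have [] := hf.1 _ evp.
move=> t t0t tT k.
have vge0 l s : t0 < s -> (s%:E < Tq)%E -> 0 <= v s l ord0.
  by move=> t0s sT; have /andP[] := hv01 s (ltW t0s) sT l.
rewrite lt_neqAle vge0// andbT eq_sym; apply/eqP => vk.
have := derive_eq0_at_zero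
  (fun s t0s sT => is_derive_coord k ord0 (dv s t0s sT)) (vge0 k) t0t tT vk.
apply/eqP; rewrite gt_eqF// mxE ltr_wpDl//.
- apply: offdiag_ge0_mulmx => // [|l]; last exact: vge0.
  exact: system_mx_offdiag_ge0.
- exact: reaction_gt0.
Qed.
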